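(* For every $n\ge 1$, the graph $S(n,3)$ has nested solutions for the edge-isoperimetric problem given by lexicographic order; that is, for every integer $\ell$ with $0\le \ell\le 3^n$, the set $Lex^{-1}(\{1,2,\dots,\ell\})$ satisfies $$|\Theta(Lex^{-1}(\{1,\dots,\ell\}))|=\min\{|\Theta(S)| : S\subseteq V_{S(n,3)},\ |S|=\ell\}.$$
   Context: For $n\ge 1$, $m\ge 2$, the generalized and expanded Sierpinski graph $S(n,m)$ has vertex set $V_{S(n,m)}=\{0,1,\dots,m-1\}^n$; two distinct vertices $u,v$ are joined by an edge iff there is $h\in\{1,\dots,n\}$ such that $u_i=v_i$ for $1\le i<h$, $u_h\ne v_h$, and $u_j=v_h$, $v_j=u_h$ for all $h<j\le n$. For a graph $G=(V,E)$ and $S\subseteq V$, the edge-boundary is $\Theta(S)=\{\{v,w\}\in E: v\in S,\ w\notin S\}$. The lexicographic numbering $Lex:\{0,\dots,m-1\}^n\to\{1,\dots,m^n\}$ is $Lex(v)=1+\sum_{i=1}^n v_i m^{n-i}$. *)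

(* Defs.v *)
From mathcomp Require Import all_boot.

Set Implicit Arguments.
Unset Strict Implicit.
Unset Printing Implicit Defensive.

(** Edges are unordered pairs, so that cardinalities count each edge once. *)
Definition edges (T : finType) (adj : rel T) : {set {set T}} :=
  [set e | [exists u, exists v, adj u v && (e == [set u; v])]].

Definition edge_boundary (T : finType) (E : {set {set T}}) (S : {set T}) :
    {set {set T}} :=
  [set e in E | [exists v, exists w,
     [&& e == [set v; w], v \in S & w \notin S]]].

(** Coordinates are indexed from 0: [v i] is the usual v_{i+1}. *)
Definition word (n m : nat) : finType := {ffun 'I_n -> 'I_m}.

Definition sierpinski_adj (n m : nat) : rel (word n m) :=
  fun u v => [exists h : 'I_n,
    [&& [forall i : 'I_n, (i < h) ==> (u i == v i)],
        u h != v h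
      & [forall j : 'I_n, (h < j) ==> (u j == v h) && (v j == u h)]]].

Definition sierpinski_edges (n m : nat) : {set {set word n m}} :=
  edges (@sierpinski_adj n m).

(** The exponent n - i.+1 and the leading 1 match coordinates numbered from 1
    and values in {1, ..., m ^ n}. *)
Definition lex (n m : nat) (v : word n m) : nat :=
  1 + \sum_(i < n) v i * m ^ (n - i.+1).

Definition lex_initial (n m l : nat) : {set word n m} :=
  [set v | 1 <= lex v <= l].

Definition is_min (A : nat -> Prop) (k : nat) : Prop :=
  A k /\ forall j, A j -> k <= j.

(* Main.v *)
(* Let weight n x be the number of nonzero balanced ternary digits of x modulo
   3 ^ n, which is subadditive because it is the least number of terms
   +- 3 ^ k with sum x.  A set S with 0 < |S| < 3 ^ n has edge boundary at
   least 1 + weight n |S|, with equality for lexicographic initial segments.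
   Cut S(n+1,3) into its three copies of S(n,3).  The lower bound is clear by
   subadditivity if at least two copies are properly met, since each pays its
   own 1.  With only one such copy the joining edges must pay for the new
   leading digit.  The induction closes once it also says that one more edge
   is cut when S has more than half of the vertices but at most one corner, or
   dually less than half of them but at least two corners. *)
Require Import Defs.
From mathcomp Require Import all_boot zify.

Set Implicit Arguments.
Unset Strict Implicit.
Unset Printing Implicit Defensive.

(** * Balanced ternary weight *)

Lemma odd_exp3 n : odd (3 ^ n).
Proof. by rewrite oddX orbT. Qed.

(* Number of nonzero digits of x mod 3 ^ n in base 3 with digits -1, 0, 1:
   [x.+1 %/ 3] rounds x / 3 to the nearest integer. *)
Fixpoint weight (n x : nat) : nat :=
  if n is n'.+1 then (x %% 3 != 0) + weight n' (x.+1 %/ 3) else 0.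

Lemma weight0 n : weight n 0 = 0.
Proof. by elim: n => //= n IH; rewrite divn_small. Qed.

(** A carry occurs only when the last digit is 1. That digit becomes -1, still nonzero, and the rest
    again changes by one. *)
Lemma weight_succ n x :
  weight n x.+1 <= weight n x + 1 /\ weight n x <= weight n x.+1 + 1.
Proof.
elim: n x => //= n IH x; have [IH1 IH2] := IH (x.+1 %/ 3).
have [[-> Hx]|[-> Hx]] : (x.+2 %/ 3 = x.+1 %/ 3 /\ x %% 3 != 1)
   \/ (x.+2 %/ 3 = (x.+1 %/ 3).+1 /\ x %% 3 = 1) by lia.
- by lia.
- by lia.
Qed.

(** The last digits carry only when both are 1 or both are -1. The sum then has a single nonzero
    last digit, and the one saved pays for the carry by [weight_succ]. *)
Lemma leq_weightD n x y : weight n (x + y) <= weight n x + weight n y.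
Proof.
elim: n x y => //= n IH x y.
set a := x.+1 %/ 3; set b := y.+1 %/ 3.
have := IH a b; have [/= up _] := weight_succ n (a + b).
have [_ down] := weight_succ n ((x + y).+1 %/ 3).
have [E|[[E Hd]|[E Hd]]] : (x + y).+1 %/ 3 = a + b
   \/ ((x + y).+1 %/ 3 = (a + b).+1 /\ x %% 3 = 1 /\ y %% 3 = 1)
   \/ (((x + y).+1 %/ 3).+1 = a + b /\ x %% 3 = 2 /\ y %% 3 = 2)
  by rewrite /a /b; lia.
- by rewrite E; lia.
- by rewrite E; lia.
- by rewrite E in down; lia.
Qed.

Lemma weight_period n x : weight n (x + 3 ^ n) = weight n x.
Proof.
elim: n x => //= n IH x; rewrite expnS.
by rewrite (_ : (x + 3 * 3 ^ n).+1 %/ 3 = x.+1 %/ 3 + 3 ^ n) ?IH; lia.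
Qed.

Lemma weight_periodM n x k : weight n (x + 3 ^ n * k) = weight n x.
Proof.
by elim: k => [|k IH]; rewrite ?muln0 ?addn0 // mulnSr addnA weight_period.
Qed.

Lemma weight_exp3 n : weight n (3 ^ n) = 0.
Proof. by rewrite -[3 ^ n]add0n weight_period weight0. Qed.

(** Negation modulo [3 ^ n] flips the sign of every digit. *)
Lemma weight_opp n x y : x + y = 3 ^ n -> weight n x = weight n y.
Proof.
elim: n x y => //= n IH x y; rewrite expnS => E.
by rewrite (IH (x.+1 %/ 3) (y.+1 %/ 3)); lia.
Qed.

(* Passing from n to n + 1 adds one leading digit, which is 0 iff x is within
   3 ^ n / 2 of a multiple of 3 ^ n.+1. *)
Lemma weight_top n x : x <= 3 ^ n.+1 ->
  weight n.+1 x = weight n x + (3 ^ n < 2 * x < 5 * 3 ^ n).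
Proof.
elim: n x => [|n IH] x le_x.
  by case: x le_x => [|[|[|[|x]]]].
rewrite [LHS]/= -/(weight n.+1 _) IH; last by rewrite !expnS in le_x *; lia.
have odd_N := odd_exp3 n.
rewrite [weight n.+1 x]/= !expnS in le_x *; move: (weight n _) => w; lia.
Qed.

Arguments weight : simpl never.

(** With each summand replaced by its balanced residue modulo [N], subadditivity leaves only the
    correction [N * (a + b + c)]: a single leading digit, which vanishes modulo [3 * N] when 0 or 3
    summands exceed [N / 2]. *)
Lemma leq_weight_copies n x y z : let N := 3 ^ n in x <= N -> y <= N -> z <= N ->
  weight n.+1 (x + y + z) <= weight n x + weight n y + weight n z
    + (1 <= (N < 2 * x) + (N < 2 * y) + (N < 2 * z) <= 2).
Proof.
move=> N Hx Hy Hz.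
have odd_N : odd N by exact: odd_exp3.
(* Modulo 3 ^ n.+1, adding 2 * N subtracts N, so u becomes its balanced
   residue modulo N, whose leading digit is 0. *)
have E u : u <= N -> weight n.+1 (u + 2 * N * (N < 2 * u)) = weight n u.
  move=> Hu; rewrite weight_top -/N; last by rewrite expnS; lia.
  case: (ltnP N (2 * u)) => H.
    by rewrite (_ : u + 2 * N * true = u + 3 ^ n + 3 ^ n) ?weight_period; lia.
  by rewrite muln0 addn0; lia.
rewrite -(E x) // -(E y) // -(E z) //.
set a := (N < 2 * x); set b := (N < 2 * y); set c := (N < 2 * z).
have := leq_weightD n.+1 (x + 2 * N * a) (y + 2 * N * b).
have := leq_weightD n.+1 (x + 2 * N * a + (y + 2 * N * b)) (z + 2 * N * c).
set X := (x + 2 * N * a + (y + 2 * N * b) + _).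
have := leq_weightD n.+1 X (N * (a + b + c)).
rewrite (_ : X + _ = x + y + z + 3 ^ n.+1 * (a + b + c)); last first.
  by rewrite /X expnS -/N; case: (a) (b) (c) => [] [] [] /=; lia.
rewrite weight_periodM.
suff : weight n.+1 (N * (a + b + c)) <= (1 <= a + b + c <= 2) by lia.
rewrite weight_top -/N; last by rewrite expnS; lia.
by rewrite -[N * _]add0n weight_periodM weight0; case: (a) (b) (c) => [] [] []; lia.
Qed.

(* Both x and y have leading digit 0, while x + y and N + x + y
   have leading digits 1 and -1: so they have the same weight. *)
Lemma leq_weight_full_copy n l x y : let N := 3 ^ n in l = N + x + y ->
  2 * x < N -> 2 * y < N -> N < 2 * (x + y) ->
  weight n.+1 l <= weight n x + weight n y.
Proof.
move=> N -> Hx Hy Hxy.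
have L := leq_weightD n.+1 x y.
have := @weight_top n x; have := @weight_top n y.
have := @weight_top n (x + y); have := @weight_top n (N + x + y).
rewrite -addnA (addnC N) [in weight n (_ + N)]/N weight_period expnS -/N; lia.
Qed.

(** * The invariant and its induction step *)

(* The induction invariant: [l], [c0], [c1], [c2] and [t] stand for the size,
   the presence of the three corners and the edge boundary of a vertex set of
   S(n,3). *)
Definition profile (n l : nat) (c0 c1 c2 : bool) (t : nat) : Prop :=
  [\/ [/\ l = 0, c0 = false, c1 = false & c2 = false],
      [/\ l = 3 ^ n, c0, c1 & c2]
    | 0 < l < 3 ^ n /\
      1 + weight n l
        + (if 3 ^ n < 2 * l then c0 + c1 + c2 <= 1 else 2 <= c0 + c1 + c2)
      <= t].

Lemma profile_le n l c0 c1 c2 t : profile n l c0 c1 c2 t -> l <= 3 ^ n.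
Proof. by case=> [[-> *]|[-> *]|[/andP[_ /ltnW]]]. Qed.

Lemma profile_proper n l c0 c1 c2 t :
  profile n l c0 c1 c2 t -> 0 < l < 3 ^ n -> weight n l < t.
Proof.
case=> [[-> _ _ _]|[-> _ _ _]|[_ /(leq_trans _) -> //]] //.
  by rewrite ltnn andbF.
by rewrite add1n ltnS leq_addr.
Qed.

(** This lets the induction step assume more than half of the vertices. Negation preserves the
    weight, the two corner conditions are dual, and odd [3 ^ n] excludes ties. *)
Lemma profile_compl n l c0 c1 c2 t :
  profile n l c0 c1 c2 t -> profile n (3 ^ n - l) (~~ c0) (~~ c1) (~~ c2) t.
Proof.
have odd_N := odd_exp3 n; case=> [[-> -> -> ->]|[-> -> -> ->]|[Hl Ht]].
- by apply: Or32; rewrite subn0.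
- by apply: Or31; rewrite subnn.
apply: Or33; split; first by lia.
have -> : weight n (3 ^ n - l) = weight n l by apply: weight_opp; lia.
move: odd_N Hl Ht; set N := 3 ^ n; move: (weight n l) => w.
case: (ltnP N (2 * l)) => H1 odd_N Hl; case: (ltnP N (2 * (N - l))) => H2; lia.
Qed.

(** If exactly one copy is over half and some copy is full, these are the same copy. The other two
    then sum to more than [N / 2], so [leq_weight_full_copy] saves the leading digit. *)
Lemma leq_weight_copies_upper n x y z : let N := 3 ^ n in
    x <= N -> y <= N -> z <= N -> 3 * N < 2 * (x + y + z) ->
  let e := (N < 2 * x) + (N < 2 * y) + (N < 2 * z) in
  weight n.+1 (x + y + z) <= weight n x + weight n y + weight n z
    + (if e == 1 then [&& x != N, y != N & z != N] else e <= 2).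
Proof.
move=> N Hx Hy Hz upper /=; set e := _ + _ + (N < 2 * z).
have W3 := leq_weight_copies Hx Hy Hz; rewrite -/N -/e in W3.
case: eqP => [e1|e_neq1]; last first.
  by apply: leq_trans W3 _; rewrite leq_add2l; case: (e) => [|[|[|e']]].
have [Hall|] := boolP [&& x != N, y != N & z != N].
  by apply: leq_trans W3 _; rewrite e1.
have G := @leq_weight_full_copy n (x + y + z); rewrite -/N in G.
have wN : weight n N = 0 := weight_exp3 n.
have odd_N := odd_exp3 n; rewrite -/N in odd_N.
move=> {W3}; rewrite addn0 !negb_and !negbK => /or3P[] /eqP EN.
- by rewrite EN wN add0n -EN; apply: G; move: e1; rewrite /e; lia.
- by rewrite EN wN addn0 -EN; apply: G; move: e1; rewrite /e; lia.
by rewrite EN wN addn0 -EN; apply: G; move: e1; rewrite /e; lia.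
Qed.

(** The corners [x0], [y1], [z2] remain corners; the other six are paired off by the three joining
    edges, each cut exactly when its ends differ. *)
Lemma profile_step_upper n (x y z tx ty tz : nat)
    (x0 x1 x2 y0 y1 y2 z0 z1 z2 : bool) :
  profile n x x0 x1 x2 tx -> profile n y y0 y1 y2 ty ->
  profile n z z0 z1 z2 tz -> 3 ^ n.+1 < 2 * (x + y + z) ->
  profile n.+1 (x + y + z) x0 y1 z2
    (tx + ty + tz + (x1 != y0) + (x2 != z0) + (y2 != z1)).
Proof.
move=> Px Py Pz upper; rewrite expnS in upper.
have W := leq_weight_copies_upper (profile_le Px) (profile_le Py) (profile_le Pz) upper.
(* Three proper copies contribute three units besides their weights: one for the constant 1, one for
   the leading digit and one for the corner term. *)
have [/and3P[x_proper y_proper z_proper] | not_proper] :=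
    boolP [&& 0 < x < 3 ^ n, 0 < y < 3 ^ n & 0 < z < 3 ^ n].
  have {Px Py Pz} := (profile_proper Px x_proper, profile_proper Py y_proper,
                      profile_proper Pz z_proper).
  have {}W := leq_trans W (leq_add (leqnn _) (leq_b1 _)).
  have := leq_b1 (x0 + y1 + z2 <= 1).
  move: upper W x_proper y_proper z_proper; rewrite /profile expnS => upper.
  move=> W Hx Hy Hz b1 [[Px Py] Pz]; apply: Or33; rewrite upper; split.
    by move: Hx Hy Hz; clear; lia.
  by move: W Px Py Pz b1; clear; lia.
have wN := weight_exp3 n.
have w0 := weight0 n; have odd_N := odd_exp3 n.
move: Px Py Pz W upper not_proper wN w0 odd_N; rewrite /profile expnS.
move: (3 ^ n) => N; move: (weight n.+1 _) => w.
move=> Px Py Pz W upper not_proper wN w0 odd_N.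
have N0 : (N < 2 * 0) = false by [].
have NN : N < 2 * N by move: odd_N; clear; lia.
have lt_neq u : 0 < u < N -> u != N.
  by move=> /andP[_]; rewrite ltn_neqAle => /andP[].
have N_neq0 : 0 != N by move: odd_N; clear; lia.
(* Now some copy is empty or full. Comparing the proper ones with [N / 2] fixes the leading-digit
   and corner terms, after which only the corner booleans are enumerated. *)
case: Px => [[xE -> -> ->]|[xE -> -> ->]|[xE Px]];
case: Py => [[yE -> -> ->]|[yE -> -> ->]|[yE Py]];
case: Pz => [[zE -> -> ->]|[zE -> -> ->]|[zE Pz]];
rewrite ?xE ?yE ?zE ?N0 ?NN ?wN ?w0 ?eqxx in upper W *;
  try by rewrite xE yE zE in not_proper.
all: try (exfalso; clear W N0 NN; by lia).
all: try (by apply: Or32; split=> //; lia).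
all: apply: Or33; rewrite upper; split; first by clear W; lia.
all: try rewrite (lt_neq _ xE) in W; try rewrite (lt_neq _ yE) in W.
all: try rewrite (lt_neq _ zE) in W.
all: rewrite ?N_neq0 in W; clear wN w0 N0 NN lt_neq N_neq0.
all: move: W; try move: Px; try move: Py; try move: Pz.
all: move: (weight n x) (weight n y) (weight n z) => wx wy wz.
all: try (match type of xE with is_true _ => have [ex|ex] := ltnP N (2 * x) end).
all: try (match type of yE with is_true _ => have [ey|ey] := ltnP N (2 * y) end).
all: try (match type of zE with is_true _ => have [ez|ez] := ltnP N (2 * z) end).
all: try (exfalso; move: upper xE yE zE;
  try move: ex; try move: ey; try move: ez; clear; by lia).
all: clear -w tx ty tz.
all: repeat match goal with b : bool |- _ => case: b end.
all: by rewrite /=; clear; lia.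
Qed.

Lemma profile_step n (x y z tx ty tz : nat)
    (x0 x1 x2 y0 y1 y2 z0 z1 z2 : bool) :
  profile n x x0 x1 x2 tx -> profile n y y0 y1 y2 ty ->
  profile n z z0 z1 z2 tz ->
  profile n.+1 (x + y + z) x0 y1 z2
    (tx + ty + tz + (x1 != y0) + (x2 != z0) + (y2 != z1)).
Proof.
move=> Px Py Pz.
have [|lower] := ltnP (3 ^ n.+1) (2 * (x + y + z)).
  exact: profile_step_upper.
have := profile_step_upper (profile_compl Px) (profile_compl Py) (profile_compl Pz).
have [Hx Hy Hz] := And3 (profile_le Px) (profile_le Py) (profile_le Pz).
have -> : 3 ^ n - x + (3 ^ n - y) + (3 ^ n - z) = 3 ^ n.+1 - (x + y + z).
  by rewrite expnS; lia.
have upper : 3 ^ n.+1 < 2 * (3 ^ n.+1 - (x + y + z)).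
  by have := odd_exp3 n.+1; lia.
move=> /(_ upper)/profile_compl.
rewrite !negbK subKn; last by rewrite expnS; lia.
by case: x1 x2 y0 y2 z0 z1 {Px Py Pz} => [] [] [] [] [] [].
Qed.

(** * Edge boundary as a sum over ordered pairs *)

Definition boundary (T : finType) (adj : rel T) (S : {set T}) : nat :=
  \sum_(u in S) \sum_(v | v \notin S) adj u v.

(** A boundary edge has exactly one end in [S], so it comes from exactly one ordered pair in [D]. *)
Lemma card_edge_boundary (T : finType) (adj : rel T) (S : {set T}) :
  symmetric adj -> #|edge_boundary (edges adj) S| = boundary adj S.
Proof.
move=> sym_adj.
pose D := [set p : T * T | [&& adj p.1 p.2, p.1 \in S & p.2 \notin S]].
have -> : edge_boundary (edges adj) S = [set [set p.1; p.2] | p in D].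
  apply/setP=> e; rewrite !inE; apply/andP/imsetP.
    case=> /existsP[u /existsP[v /andP[uv /eqP eE]]].
    case/existsP=> v' /existsP[w /and3P[/eqP e'E v'S wS]].
    have v'e : v' \in [set u; v] by rewrite -eE e'E set21.
    have we : w \in [set u; v] by rewrite -eE e'E set22.
    have v'w : v' != w by apply: contraNneq wS => <-.
    exists (v', w) => //; rewrite inE /= v'S wS !andbT /=.
    case/set2P: v'e v'w => ->; case/set2P: we => ->; rewrite ?eqxx // => _ //.
    by rewrite sym_adj.
  case=> -[u v]; rewrite inE /= => /and3P[uv uS vS] ->; split.
    by apply/existsP; exists u; apply/existsP; exists v; rewrite uv eqxx.
  by apply/existsP; exists u; apply/existsP; exists v; rewrite uS vS eqxx.
rewrite card_in_imset; last first.
  move=> [u v] [u' v']; rewrite !inE /= => /and3P[_ uS vS] /and3P[_ u'S v'S] E.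
  have := set21 u v; rewrite E => /set2P[->|uv']; last by rewrite -uv' uS in v'S.
  have := set22 u v; rewrite E => /set2P[vu'|->] //.
  by rewrite vu' u'S in vS.
rewrite /boundary pair_big_dep /= -sum1dep_card big_mkcond [RHS]big_mkcond /=.
apply: eq_bigr => -[u v] _ /=; case: (adj u v) (u \in S) (v \notin S) => [] [] [] //.
Qed.

(** * Splitting the graph by the leading letter *)

Definition consw n m (a : 'I_m) (v : word n m) : word n.+1 m :=
  [ffun i => if unlift ord0 i is Some j then v j else a].

(** The corners of the graph, at which copies are joined. *)
Definition constw n m (a : 'I_m) : word n m := [ffun=> a].
Arguments constw : clear implicits.

Lemma constwS n m (a : 'I_m) : constw n.+1 m a = consw a (constw n m a).
Proof.
by apply/ffunP=> i; rewrite !ffunE; case: unliftP => // j _; rewrite ffunE.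
Qed.

Definition slice n m (a : 'I_m) (S : {set word n.+1 m}) : {set word n m} :=
  [set v | consw a v \in S].

Lemma big_consw n m (P : pred (word n.+1 m)) (F : word n.+1 m -> nat) :
  \sum_(u | P u) F u = \sum_a \sum_(v | P (consw a v)) F (consw a v).
Proof.
pose h (p : 'I_m * word n m) := consw p.1 p.2.
pose k (u : word n.+1 m) : 'I_m * word n m := (u ord0, [ffun j => u (lift ord0 j)]).
have hK : cancel h k.
  move=> [a v]; rewrite /h /k /consw /= !ffunE unlift_none; congr pair.
  by apply/ffunP=> j; rewrite !ffunE liftK.
have kK : cancel k h.
  move=> u; apply/ffunP=> i; rewrite /h /k !ffunE /=.
  by case: unliftP => [j ->|->] //=; rewrite ffunE.
rewrite (reindex h) /=; last by exists k => x _; [apply: hK | apply: kK].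
by rewrite -(pair_big_dep xpredT (fun a v => P (consw a v)) (fun a v => F (consw a v))).
Qed.

Lemma consw0 n m (a : 'I_m) (v : word n m) : consw a v ord0 = a.
Proof. by rewrite ffunE unlift_none. Qed.

Lemma consw_lift n m (a : 'I_m) (v : word n m) j : consw a v (lift ord0 j) = v j.
Proof. by rewrite ffunE liftK. Qed.

Lemma sierpinski_adj_sym n m : symmetric (@sierpinski_adj n m).
Proof.
move=> u v; apply: eq_existsb => h; congr [&& _, _ & _].
- by apply: eq_forallb => i; rewrite eq_sym.
- by rewrite eq_sym.
by apply: eq_forallb => i; rewrite andbC.
Qed.

Lemma forall_ordS n (P : pred 'I_n.+1) :
  [forall i, P i] = P ord0 && [forall i, P (lift ord0 i)].
Proof.
apply/forallP/andP => [H|[H0 /forallP H] i].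
  by split=> //; apply/forallP => i.
by case: (unliftP ord0 i) => [j ->|->].
Qed.

Lemma exists_ordS n (P : pred 'I_n.+1) :
  [exists i, P i] = P ord0 || [exists i, P (lift ord0 i)].
Proof.
apply: negb_inj; rewrite negb_exists negb_or negb_exists.
exact: (forall_ordS (fun i => ~~ P i)).
Qed.

Lemma eq_constw n m (u : word n m) (b : 'I_m) :
  (u == constw n m b) = [forall j, u j == b].
Proof.
apply/eqP/forallP => [-> j|H]; first by rewrite ffunE.
by apply/ffunP=> j; rewrite ffunE; apply/eqP.
Qed.

(** Distinct leading letters force [h] to be the first position, which makes both tails constant;
    equal ones force [h] to lie in the tails. *)
Lemma adj_consw n m (a b : 'I_m) (u v : word n m) :
  sierpinski_adj (consw a u) (consw b v) =
    if a == b then sierpinski_adj u v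
    else (u == constw n m b) && (v == constw n m a).
Proof.
rewrite /sierpinski_adj exists_ordS !consw0 -[in RHS](negbK (a == b)).
have -> : [forall i : 'I_n.+1, (i < @ord0 n) ==> (consw a u i == consw b v i)].
  by apply/forallP.
have -> : [forall j : 'I_n.+1,
      (@ord0 n < j) ==> (consw a u j == b) && (consw b v j == a)]
    = (u == constw n m b) && (v == constw n m a).
  rewrite forall_ordS /= !eq_constw.
  apply/forallP/andP=> [H|[/forallP Hu /forallP Hv] j].
    by split; apply/forallP=> j; have := H j; rewrite !consw_lift => /andP[].
  by rewrite !consw_lift Hu Hv.
case: (altP (a =P b)) => [->|ab] /=.
  apply: eq_existsb => h; rewrite forall_ordS !consw0 eqxx /= !consw_lift.
  congr [&& _, _ & _]; first by apply: eq_forallb => i; rewrite !consw_lift.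
  by rewrite forall_ordS /=; apply: eq_forallb => i; rewrite !consw_lift.
rewrite orbC; case: existsP => // -[h].
by rewrite forall_ordS !consw0 (negbTE ab).
Qed.

Lemma boundary_consw n m (S : {set word n.+1 m}) :
  boundary (@sierpinski_adj n.+1 m) S =
    \sum_(a < m) boundary (@sierpinski_adj n m) (slice a S)
    + \sum_(a < m) \sum_(b < m | b != a)
        ((constw n m b \in slice a S) && (constw n m a \notin slice b S)).
Proof.
rewrite /boundary big_consw -big_split; apply: eq_bigr => a _ /=.
under eq_bigr => u _ do rewrite big_consw (bigD1 a) //=.
rewrite big_split /=; congr (_ + _).
  rewrite (eq_bigl (fun u => u \in slice a S)); last by move=> u; rewrite inE.
  apply: eq_bigr => u _; rewrite (eq_bigl (fun v => v \notin slice a S)).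
    by apply: eq_bigr => v _; rewrite adj_consw eqxx.
  by move=> v; rewrite inE.
rewrite exchange_big /=; apply: eq_bigr => b ba.
have ab : (a == b) = false by rewrite eq_sym (negbTE ba).
rewrite (eq_bigl (fun u => u \in slice a S)); last by move=> u; rewrite inE.
under eq_bigr => u _ do under eq_bigr => v _ do rewrite adj_consw ab.
(* The only edge between copies [a] and [b] joins corner [b] of the former to corner [a] of the
   latter. *)
rewrite big_mkcond (bigD1 (constw n m b)) //=.
rewrite [X in _ + X]big1 => [|u /negbTE ub]; last first.
  by case: ifP => // _; apply: big1 => v _; rewrite ub.
rewrite addn0 eqxx /=; case: (_ \in slice a S) => //=.
rewrite big_mkcond (bigD1 (constw n m a)) //=.
rewrite [X in _ + X]big1 => [|v /negbTE va]; last first.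
  by case: ifP => //; rewrite va.
by rewrite addn0 eqxx inE; case: (_ \in S).
Qed.

Lemma card_consw n m (S : {set word n.+1 m}) : #|S| = \sum_(a < m) #|slice a S|.
Proof.
rewrite -sum1_card big_consw; apply: eq_bigr => a _.
by rewrite -sum1_card; apply: eq_bigl => v; rewrite inE.
Qed.

(** * Slices, corners and sizes of initial segments *)

Lemma lex_consw n m (a : 'I_m) (v : word n m) : lex (consw a v) = a * m ^ n + lex v.
Proof.
rewrite /lex big_ord_recl consw0 subn1 /= addnCA; congr (_ + (_ + _)).
by apply: eq_bigr => i _; rewrite consw_lift.
Qed.

(** Truncated subtraction yields the empty slice for copies not yet reached; a length above [m ^ n]
    yields a full one. *)
Lemma slice_lex_initial n m l (a : 'I_m) :
  slice a (lex_initial n.+1 m l) = lex_initial n m (l - a * m ^ n).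
Proof.
by apply/setP=> v; rewrite !inE lex_consw /lex; lia.
Qed.

(** By the geometric sum, corner [b] has rank [1 + b * (3 ^ n - 1) / 2]; doubling avoids the
    division. *)
Lemma lex_constw_le n (b : 'I_3) l :
  (constw n 3 b \in lex_initial n 3 l) = (2 + b * (3 ^ n).-1 <= 2 * l).
Proof.
rewrite inE.
suff <- : 2 * lex (constw n 3 b) = 2 + b * (3 ^ n).-1.
  by have lex_gt0 : 0 < lex (constw n 3 b) by []; rewrite lex_gt0 leq_mul2l.
elim: n => [|n IH]; first by rewrite /lex big_ord0 /= muln0.
have := expn_gt0 3 n; rewrite constwS lex_consw mulnDr IH expnS; nia.
Qed.

Lemma card_lex_initial n l : #|lex_initial n 3 l| = minn l (3 ^ n).
Proof.
elim: n l => [|n IH] l.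
  rewrite -sum1_card (eq_bigl (fun=> 0 < l)); last by move=> v; rewrite inE /lex big_ord0.
  case: l => [|l]; first by rewrite big_pred0_eq.
  by rewrite sum1_card cardT -cardE card_ffun !card_ord; lia.
rewrite card_consw !big_ord_recl big_ord0 !slice_lex_initial !IH /= /bump /= expnS; lia.
Qed.

(** * Lower bound for arbitrary sets *)

Lemma big_ord3 (F : 'I_3 -> nat) : \sum_a F a = F (inord 0) + F (inord 1) + F (inord 2).
Proof.
rewrite !big_ord_recl big_ord0 addn0 addnA.
by congr (F _ + F _ + F _); apply: val_inj; rewrite /= inordK.
Qed.

Lemma boundary_consw3 n (S : {set word n.+1 3}) :
  let c a b := constw n 3 (inord b) \in slice (inord a) S in
  boundary (@sierpinski_adj n.+1 3) S =
    boundary (@sierpinski_adj n 3) (slice (inord 0) S)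
    + boundary (@sierpinski_adj n 3) (slice (inord 1) S)
    + boundary (@sierpinski_adj n 3) (slice (inord 2) S)
    + (c 0 1 != c 1 0) + (c 0 2 != c 2 0) + (c 1 2 != c 2 1).
Proof.
move=> c; rewrite boundary_consw big_ord3 -!addnA; do 3! congr (_ + _).
under eq_bigr => a _ do rewrite big_mkcond big_ord3.
rewrite big_ord3 -!val_eqE /= !inordK //= /c.
by do 6! case: (_ \in slice _ _).
Qed.

Lemma card_consw3 n (S : {set word n.+1 3}) :
  #|S| = #|slice (inord 0) S| + #|slice (inord 1) S| + #|slice (inord 2) S|.
Proof. by rewrite card_consw big_ord3. Qed.

Lemma boundary_profile n (S : {set word n 3}) :
  profile n #|S| (constw n 3 (inord 0) \in S) (constw n 3 (inord 1) \in S)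
    (constw n 3 (inord 2) \in S) (boundary (@sierpinski_adj n 3) S).
Proof.
elim: n S => [|n IH] S; last first.
  rewrite card_consw3 boundary_consw3 !constwS.
  (* Corner [a] of the large graph is corner [a] of its copy [a]. *)
  have cE a : (consw a (constw n 3 a) \in S) = (constw n 3 a \in slice a S).
    by rewrite inE.
  by rewrite !cE; apply: profile_step.
have eq_word (u v : word 0 3) : u = v by apply/ffunP => -[].
have [->|/set0Pn[u uS]] := eqVneq S set0.
  by apply: Or31; rewrite cards0 !inE.
have -> : S = setT by apply/setP=> v; rewrite inE (eq_word v u).
by apply: Or32; rewrite cardsT card_ffun !card_ord !inE.
Qed.

(** The value 0 for [l] above [3 ^ n] also covers full slices of initial segments. *)
Definition min_boundary (n l : nat) : nat :=
  if 0 < l < 3 ^ n then (weight n l).+1 else 0.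

Lemma min_boundary_le n (S : {set word n 3}) :
  min_boundary n #|S| <= boundary (@sierpinski_adj n 3) S.
Proof.
by rewrite /min_boundary; case: ifP => // /(profile_proper (boundary_profile S)).
Qed.

(** * Equality for initial segments *)

Lemma lex_corner n l :
  let N := 3 ^ n in let c b := constw n 3 (inord b) \in lex_initial n 3 l in
  [/\ c 0 = (0 < l), c 1 = (N < 2 * l) & c 2 = (N <= l)].
Proof.
have odd_N := odd_exp3 n.
by rewrite /= !lex_constw_le !inordK //; split; lia.
Qed.

(** At most one slice is proper, since copies fill one after another. The cut joining edges then
    match the new leading digit given by [weight_top]. *)
Lemma boundary_lex_initial n l :
  boundary (@sierpinski_adj n 3) (lex_initial n 3 l) = min_boundary n l.
Proof.
elim: n l => [|n IH] l.
  rewrite /min_boundary expn0; case: ifP => [|_]; first by lia.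
  rewrite /boundary big1 // => u _; rewrite big1 // => v _.
  by rewrite /sierpinski_adj; case: existsP => // -[[]].
rewrite boundary_consw3 !slice_lex_initial !IH !inordK // mul0n subn0 mul1n.
have [c00 c01 c02] := lex_corner n l.
have [c10 c11 c12] := lex_corner n (l - 3 ^ n).
have [c20 c21 c22] := lex_corner n (l - 2 * 3 ^ n).
rewrite {}c01 {}c02 {}c10 {}c12 {}c20 {}c21 {c00 c11 c22 IH} /min_boundary expnS.
have odd_N := odd_exp3 n; have w0 := weight0 n.
have T := @weight_top n l; rewrite expnS in T.
have P r k : weight n (k * 3 ^ n + r) = weight n r.
  by rewrite addnC mulnC weight_periodM.
move: (3 ^ n) (weight n.+1 l) odd_N T P => N w odd_N T P.
have [lt_lN|le_Nl] := ltnP l N.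
  have [-> ->] : l - N = 0 /\ l - 2 * N = 0 by lia.
  rewrite !T; last by lia.
  move: odd_N lt_lN; move: (weight n l) => u; clear=> odd_N lt_lN /=.
  by do ![case: ifP => ?]; lia.
have [lt_l2N|le_2Nl] := ltnP l (2 * N).
  have -> : l - 2 * N = 0 by lia.
  have Er := subnKC le_Nl; move: (l - N) Er T => r <- {le_Nl} T in lt_l2N *.
  have -> : w = weight n r + (N < 2 * (N + r) < 5 * N).
    by rewrite T -?(P r 1) ?mul1n //; lia.
  (* When [r = 0] no slice is proper, and a cut joining edge supplies the constant 1 instead. *)
  have : r = 0 -> weight n r = 0 by move=> ->.
  move: odd_N lt_l2N; move: (weight n r) => u; clear=> odd_N lt_l2N u0 /=.
  by do ![case: ifP => ?]; lia.
have [lt_l3N|le_3Nl] := ltnP l (3 * N); last first.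
  move: odd_N le_3Nl; clear=> odd_N le_3Nl.
  by do ![case: ifP => ?]; lia.
have Er := subnKC le_2Nl; have -> : l - N = N + (l - 2 * N) by lia.
move: (l - 2 * N) Er T => r <- {le_2Nl} T in lt_l3N *.
have -> : w = weight n r + (N < 2 * (2 * N + r) < 5 * N).
  by rewrite T -?(P r 2) //; lia.
have : r = 0 -> weight n r = 0 by move=> ->.
move: odd_N lt_l3N; move: (weight n r) => u; clear=> odd_N lt_l3N u0 /=.
by do ![case: ifP => ?]; lia.
Qed.

Theorem theorem8 (n : nat) (n_ge1 : 1 <= n) (l : nat) (l_le : l <= 3 ^ n) :
  #|lex_initial n 3 l| = l /\
  is_min
    (fun k => exists2 S : {set word n 3},
       #|S| = l & k = #|edge_boundary (sierpinski_edges n 3) S|)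
    #|edge_boundary (sierpinski_edges n 3) (lex_initial n 3 l)|.
Proof.
have card_lex : #|lex_initial n 3 l| = l by rewrite card_lex_initial (minn_idPl l_le).
split=> //; split=> [|_ [S cardS ->]]; first by exists (lex_initial n 3 l).
rewrite !card_edge_boundary; try exact: sierpinski_adj_sym.
by rewrite boundary_lex_initial -cardS min_boundary_le.
Qed.
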